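(* Let $1<\alpha\le 2$, $\varepsilon>0$, let $M_x,M_y,M_z\ge 2$ be integers, $h_1=1/M_x$, $h_2=1/M_y$, $h_3=1/M_z$, let $N$ be a positive integer and $\Delta t=T/N$ with $T>0$. Let $u_0:\overline{\Omega}=[0,1]^3\to\mathbb{R}$ (vanishing on $\partial\Omega$) satisfy $\max_{x\in\overline{\Omega}}|u_0(x)|\le 1$, and let $U^n=(U^n_{i,j,k})$, $n=0,1,\dots,N$, be the numerical solution produced from $U^0_{i,j,k}=u_0(x_i,y_j,z_k)$ by the fourth-order operator splitting ADI scheme (defined in the context) with these parameters. If the time step satisfies $$\frac{\alpha+2}{12}\,\frac{\max(h_1^{\alpha},h_2^{\alpha},h_3^{\alpha})}{\varepsilon^2c_0^{\alpha}}\ \le\ \Delta t\ \le\ \frac{12-\alpha}{6}\,\frac{\min(h_1^{\alpha},h_2^{\alpha},h_3^{\alpha})}{\varepsilon^2c_0^{\alpha}},$$ then $\|U^n\|_\infty\le 1$ for every $n=0,1,\dots,N$ (discrete maximum principle).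
   Context: Grid: $x_i=ih_1$, $y_j=jh_2$, $z_k=kh_3$ for $0\le i\le M_x$, $0\le j\le M_y$, $0\le k\le M_z$. All grid functions are real valued, indexed by $(i,j,k)$, and take the value $0$ whenever $i\in\{0,M_x\}$, $j\in\{0,M_y\}$ or $k\in\{0,M_z\}$ (homogeneous Dirichlet condition). Norm: $\|U\|_\infty=\max\{|U_{i,j,k}|:1\le i\le M_x-1,\ 1\le j\le M_y-1,\ 1\le k\le M_z-1\}$. Coefficients: for $s\in\mathbb{Z}$, $c_s^{\alpha}=\dfrac{(-1)^s\Gamma(\alpha+1)}{\Gamma(\frac{\alpha}{2}-s+1)\Gamma(\frac{\alpha}{2}+s+1)}$, with $1/\Gamma=0$ at the poles of $\Gamma$; in particular $c_0^\alpha=\Gamma(\alpha+1)/\Gamma(\frac{\alpha}{2}+1)^2$. Operators, at interior indices $(i,j,k)$ (the result being again set to zero at boundary indices): $[\Delta_x^{\alpha}u]_{i,j,k}=-\sum_{s=1}^{M_x-1}c_{i-s}^{\alpha}u_{s,j,k}$, $[\Delta_y^{\alpha}u]_{i,j,k}=-\sum_{s=1}^{M_y-1}c_{j-s}^{\alpha}u_{i,s,k}$, $[\Delta_z^{\alpha}u]_{i,j,k}=-\sum_{s=1}^{M_z-1}c_{k-s}^{\alpha}u_{i,j,s}$; $\mathcal{A}_x^{\alpha}u_{i,j,k}=\frac{\alpha}{24}u_{i-1,j,k}+(1-\frac{\alpha}{12})u_{i,j,k}+\frac{\alpha}{24}u_{i+1,j,k}$, and $\mathcal{A}_y^{\alpha},\mathcal{A}_z^{\alpha}$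 are defined in the same way acting on the indices $j$ and $k$ respectively. Put $\beta_x=\Delta t\,\varepsilon^2/(2h_1^{\alpha})$, $\beta_y=\Delta t\,\varepsilon^2/(2h_2^{\alpha})$, $\beta_z=\Delta t\,\varepsilon^2/(2h_3^{\alpha})$. Scheme (for the fractional Allen-Cahn equation $u_t=\varepsilon^2L_\alpha u+u-u^3$ on $[0,1]^3$ with zero boundary values). Given $U^n$, $U^{n+1}$ is computed by: Step 1 (pointwise): $\tilde u^{n+1}=\dfrac{U^n}{\sqrt{(U^n)^2+(1-(U^n)^2)e^{-\Delta t}}}$; set $\bar u^n=\tilde u^{n+1}$. Step 2 (ADI): solve successively, at all interior indices, $(\mathcal{A}_x^{\alpha}-\beta_x\Delta_x^{\alpha})\bar u^{*}=(\mathcal{A}_x^{\alpha}+\beta_x\Delta_x^{\alpha})(\mathcal{A}_y^{\alpha}+\beta_y\Delta_y^{\alpha})(\mathcal{A}_z^{\alpha}+\beta_z\Delta_z^{\alpha})\bar u^{n}$, $(\mathcal{A}_y^{\alpha}-\beta_y\Delta_y^{\alpha})\bar u^{**}=\bar u^{*}$, $(\mathcal{A}_z^{\alpha}-\beta_z\Delta_z^{\alpha})\bar u^{n+1}=\bar u^{**}$. Step 3 (pointwise): $U^{n+1}=\hat u^{n+1}=\dfrac{\bar u^{n+1}}{\sqrt{(\bar u^{n+1})^2+(1-(\bar u^{n+1})^2)e^{-\Delta t}}}$. *)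

(* Defs.v *)
From HB Require Import structures.
From mathcomp Require Import all_boot all_order all_algebra.
From mathcomp Require Import all_classical all_reals all_analysis.

Set Implicit Arguments.
Unset Strict Implicit.
Unset Printing Implicit Defensive.
Import Order.TTheory GRing.Theory Num.Theory.
Import numFieldNormedType.Exports.
Local Open Scope classical_set_scope.
Local Open Scope ring_scope.

(* Euler's integral; it is the Gamma function for x > 0 only. *)
Definition euler_integral (R : realType) (x : R) : R :=
  \int[lebesgue_measure]_(t in `]0, +oo[) (t `^ (x - 1) * expR (- t)).

(* Gamma on the real line, extended to x <= 0 by Gamma x = Gamma (x + 1) / x.
   Num.truncn (1 - x) is the least n with 0 < x + n; it is 0 for x > 0.
   At the poles 0, -1, -2, ... the product has a zero factor, so 0^-1 = 0
   makes Gamma x = 0 there, and hence (Gamma x)^-1 = 0: quotients by Gamma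
   therefore follow the convention 1 / Gamma = 0 at the poles. *)
Definition Gamma (R : realType) (x : R) : R :=
  let n := Num.truncn (1 - x) in
  euler_integral (x + n%:R) / \prod_(m < n) (x + m%:R).

Definition frac_coef (R : realType) (alpha : R) (s : int) : R :=
  (-1) ^ s * Gamma (alpha + 1) /
  (Gamma (alpha / 2 - s%:~R + 1) * Gamma (alpha / 2 + s%:~R + 1)).

(* Only the values at 0 <= i <= Mx, 0 <= j <= My, 0 <= k <= Mz of a function on
   nat^3 are meaningful; values at larger indices are never used. *)
Definition gridfun (R : realType) := nat -> nat -> nat -> R.

Definition on_grid (Mx My Mz i j k : nat) : bool :=
  [&& i <= Mx, j <= My & k <= Mz]%N.

Definition interior (Mx My Mz i j k : nat) : bool :=
  [&& 0 < i < Mx, 0 < j < My & 0 < k < Mz]%N.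

Definition dirichlet (R : realType) (Mx My Mz : nat) (u : gridfun R) : Prop :=
  forall i j k, on_grid Mx My Mz i j k -> ~~ interior Mx My Mz i j k ->
    u i j k = 0.

Definition zero_boundary (R : realType) (Mx My Mz : nat) (u : gridfun R) :
    gridfun R :=
  fun i j k => if interior Mx My Mz i j k then u i j k else 0.

Definition grid_norm (R : realType) (Mx My Mz : nat) (u : gridfun R) : R :=
  \big[Num.max/0]_(1 <= i < Mx) \big[Num.max/0]_(1 <= j < My)
    \big[Num.max/0]_(1 <= k < Mz) `|u i j k|.

Definition frac_diff (R : realType) (alpha : R) (M : nat) (v : nat -> R)
    (i : nat) : R :=
  - \sum_(1 <= s < M) frac_coef alpha (i%:Z - s%:Z) * v s.

(* At i = 0 the predecessor is truncated; there zero_boundary discards it. *)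
Definition average (R : realType) (alpha : R) (v : nat -> R) (i : nat) : R :=
  alpha / 24 * v i.-1 + (1 - alpha / 12) * v i + alpha / 24 * v i.+1.

Section Operators.
Context (R : realType) (alpha : R) (Mx My Mz : nat).
Implicit Type u : gridfun R.

Definition Delta_x u : gridfun R := zero_boundary Mx My Mz
  (fun i j k => frac_diff alpha Mx (fun s => u s j k) i).
Definition Delta_y u : gridfun R := zero_boundary Mx My Mz
  (fun i j k => frac_diff alpha My (fun s => u i s k) j).
Definition Delta_z u : gridfun R := zero_boundary Mx My Mz
  (fun i j k => frac_diff alpha Mz (fun s => u i j s) k).

Definition A_x u : gridfun R := zero_boundary Mx My Mz
  (fun i j k => average alpha (fun s => u s j k) i).
Definition A_y u : gridfun R := zero_boundary Mx My Mz
  (fun i j k => average alpha (fun s => u i s k) j).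
Definition A_z u : gridfun R := zero_boundary Mx My Mz
  (fun i j k => average alpha (fun s => u i j s) k).

(* A + b Delta in each direction; b = - beta gives the implicit operators. *)
Definition op_x (b : R) u : gridfun R :=
  fun i j k => A_x u i j k + b * Delta_x u i j k.
Definition op_y (b : R) u : gridfun R :=
  fun i j k => A_y u i j k + b * Delta_y u i j k.
Definition op_z (b : R) u : gridfun R :=
  fun i j k => A_z u i j k + b * Delta_z u i j k.

End Operators.

(* Value at time dt / 2 of the solution of w_t = w - w^3 with w(0) = x. *)
Definition reaction (R : realType) (dt x : R) : R :=
  x / Num.sqrt (x ^+ 2 + (1 - x ^+ 2) * expR (- dt)).

Definition adi_beta (R : realType) (alpha eps dt h : R) : R :=
  dt * eps ^+ 2 / (2 * h `^ alpha).

Definition adi_solves (R : realType) (alpha bx by_ bz : R) (Mx My Mz : nat)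
    (u us uss v : gridfun R) : Prop :=
  [/\ [/\ dirichlet Mx My Mz us, dirichlet Mx My Mz uss &
          dirichlet Mx My Mz v],
      forall i j k, interior Mx My Mz i j k ->
        op_x alpha Mx My Mz (- bx) us i j k =
        op_x alpha Mx My Mz bx
          (op_y alpha Mx My Mz by_ (op_z alpha Mx My Mz bz u)) i j k,
      forall i j k, interior Mx My Mz i j k ->
        op_y alpha Mx My Mz (- by_) uss i j k = us i j k &
      forall i j k, interior Mx My Mz i j k ->
        op_z alpha Mx My Mz (- bz) v i j k = uss i j k].

Definition splitting_step (R : realType) (alpha eps dt h1 h2 h3 : R)
    (Mx My Mz : nat) (U V : gridfun R) : Prop :=
  exists us uss v : gridfun R,
    adi_solves alpha (adi_beta alpha eps dt h1) (adi_beta alpha eps dt h2)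
      (adi_beta alpha eps dt h3) Mx My Mz
      (fun i j k => reaction dt (U i j k)) us uss v /\
    forall i j k, on_grid Mx My Mz i j k -> V i j k = reaction dt (v i j k).

Definition numerical_solution (R : realType) (alpha eps dt h1 h2 h3 : R)
    (Mx My Mz N : nat) (u0 : R -> R -> R -> R) (U : nat -> gridfun R) : Prop :=
  (forall i j k, on_grid Mx My Mz i j k ->
     U 0%N i j k = u0 (i%:R * h1) (j%:R * h2) (k%:R * h3)) /\
  (forall n, (n < N)%N ->
     splitting_step alpha eps dt h1 h2 h3 Mx My Mz (U n) (U n.+1)).

Definition in_cube (R : realType) (x y z : R) : bool :=
  [&& 0 <= x <= 1, 0 <= y <= 1 & 0 <= z <= 1].

Definition on_cube_boundary (R : realType) (x y z : R) : bool :=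
  in_cube x y z &&
  [|| x == 0, x == 1, y == 0, y == 1, z == 0 | z == 1].

(* Main.v *)
Require Import Defs.
From mathcomp Require Import all_boot all_order all_algebra.
From mathcomp Require Import all_classical all_reals all_analysis.
From mathcomp Require Import measurable_realfun zify ring lra.
Import Order.TTheory GRing.Theory Num.Theory.
Import numFieldNormedType.Exports.
Local Open Scope classical_set_scope.
Local Open Scope ring_scope.

(** Each stage of one time step maps grid functions bounded by 1 to grid
    functions bounded by 1, so the bound passes from U^0 to every U^n.

    The reaction steps are harmless because x^2 + (1 - x^2) e^(-dt) >= x^2 when
    |x| <= 1 ([reaction_le1]).

    For the ADI step everything happens on one grid line, and rests on three
    facts about the coefficients c_s, where c_0 > 0:
    - c_1 = - alpha / (alpha + 2) c_0 ([frac_coef1]);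
    - c_s <= 0 for s <> 0 ([frac_coef_le0]);
    - the sum of c_s over any interval of indices s containing 0 is
      nonnegative ([sum_frac_coef_ge0]).
    All three follow from the symmetry c_(-s) = c_s and the recurrence
      (s + 1 + alpha/2) c_(s+1) = (s - alpha/2) c_s,
    which makes alpha c_s a telescoping difference.  The recurrence is the
    functional equation 1/Gamma(x) = x/Gamma(x+1), obtained by integrating
    Euler's integral by parts.

    Write beta for dt eps^2 / (2 h^alpha).  The upper bound on dt says that
    beta c_0 <= 1 - alpha/12: then all the entries of A + beta Delta are
    nonnegative and its row sums are at most 1, so it does not increase the
    maximum norm ([explicit_line_op_le]).  The lower bound on dt says that
    alpha/24 + beta c_1 <= 0: then A - beta Delta has nonpositive
    off-diagonal entries and row sums at least 1, so at an index where v is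
    largest and nonnegative, v is at most (A - beta Delta) v
    ([implicit_line_op_le]).  The right-hand side of the first ADI equation is a
    composition of three explicit operators, and the three equations are
    solved by three implicit ones ([adi_solves_le]). *)

(** * Euler's integral *)

(** Comparison with the term of degree k + 1 of the exponential series, where
    k >= p. *)
Lemma powR_expRN_le (R : realType) (p : R) :
  exists C : R, forall x, 1 <= x -> x `^ p * expR (- x) <= C / x.
Proof.
pose k := Num.bound `|p|; exists k.+1`!%:R => x x1.
have x0 : 0 < x := lt_le_trans ltr01 x1.
have xp : x `^ p <= x ^+ k.
  rewrite -(powR_mulrn _ (ltW x0)); apply: (ler_powR x1).
  exact: le_trans (ler_norm p) (ltW (archi_boundP (normr_ge0 _))).
have ex : x ^+ k.+1 / k.+1`!%:R <= expR x.
  by have := @expR_ge1Dxn R x k (ltW x0); lra.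
rewrite expRN ler_pdivrMr ?expR_gt0//.
apply: (le_trans xp).
have f0 : 0 < k.+1`!%:R :> R by rewrite ltr0n fact_gt0.
have : x ^+ k.+1 <= k.+1`!%:R * expR x by rewrite mulrC -ler_pdivrMr.
by rewrite exprSr mulrAC ler_pdivlMr.
Qed.

Lemma derivable_gt0_oo_LRcontinuous (R : realType) (f : R -> R) (a b : R) :
  0 < a -> a < b -> (forall t, 0 < t -> derivable f t 1) ->
  derivable_oo_LRcontinuous f a b.
Proof.
move=> a0 ab df.
have cf t : 0 < t -> {for t, continuous f}.
  by move=> t0; apply: differentiable_continuous; apply/derivable1_diffP; exact: df.
split.
- by move=> t; rewrite in_itv/= => /andP[at_ _]; exact/df/(lt_trans a0).
- exact/cvg_at_right_filter/cf.
- exact/cvg_at_left_filter/cf/(lt_trans a0).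
Qed.

(** The integration stays away from 0, where t^p need not be differentiable. *)
Lemma euler_integral_by_parts (R : realType) (p a b : R) : 0 < a -> a < b ->
  (\int[lebesgue_measure]_(t in `[a, b]) (t `^ p * expR (- t))%:E =
   (a `^ p * expR (- a) - b `^ p * expR (- b))%:E +
   p%:E * \int[lebesgue_measure]_(t in `[a, b]) (t `^ (p - 1) * expR (- t))%:E)%E.
Proof.
move=> a0 ab.
have dpow (q t : R) : 0 < t -> derivable (fun t : R => t `^ q) t 1.
  by move=> t0; apply: derivable_powR; rewrite in_itv/= andbT.
have dexp (t : R) : is_derive t 1 (fun t : R => - expR (- t)) (expR (- t)).
  by apply: is_derive_eq; rewrite /GRing.scale/=; ring.
have cW (f : R -> R) : (forall t, 0 < t -> derivable f t 1) ->
    {within `[a, b], continuous f}.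
  by move=> df; apply/derivable_oo_LRcontinuous_within/derivable_gt0_oo_LRcontinuous.
rewrite (@integration_by_parts R (fun t => t `^ p) (fun t => - expR (- t))
  (fun t => p * t `^ (p - 1)) (fun t => expR (- t)))//; first last.
- by move=> t _; rewrite derive1E derive_val.
- by apply: derivable_gt0_oo_LRcontinuous => // t _; exact: ex_derive.
- by apply: cW => t _; apply: ex_derive.
- move=> t; rewrite in_itv/= => /andP[at_ _].
  by rewrite powR_derive1// in_itv/= andbT (lt_trans a0).
- by apply: derivable_gt0_oo_LRcontinuous => // t; exact: dpow.
- by apply: cW => t t0; apply: derivableM => //; exact: dpow.
have mI (q : R) : lebesgue_measure.-integrable `[a, b]
    (fun t => (t `^ q * expR (- t))%:E).
  apply: continuous_compact_integrable; first exact: segment_compact.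
  by apply: cW => t t0; apply: derivableM; [exact: dpow|exact: ex_derive].
have -> : (\int[lebesgue_measure]_(x in `[a, b]) (p * x `^ (p - 1) * - expR (- x))%:E
   = (- p)%:E * \int[lebesgue_measure]_(x in `[a, b]) (x `^ (p - 1) * expR (- x))%:E)%E.
  rewrite -integralZl//; apply: eq_integral => t _; rewrite -EFinM; congr EFin; ring.
rewrite EFinN mulNe oppeK; congr (_ + _)%E; congr EFin; ring.
Qed.

(** For infinite I both sides are 0.  This lets the functional equation be
    proved in the extended reals, without discussing the convergence of Euler's
    integral. *)
Lemma fine_pZl (R : realType) (p : R) (I : \bar R) : p != 0 ->
  fine (p%:E * I)%E = p * fine I.
Proof.
move=> p0; case: I => [r| |]//=; rewrite mulr0.
- by rewrite mulry; case: (sgrP p) p0; rewrite ?eqxx ?mul0e ?mul1e ?mulN1e.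
- by rewrite mulrNy; case: (sgrP p) p0; rewrite ?eqxx ?mul0e ?mul1e ?mulN1e.
Qed.

Lemma itv0y_bigcup (R : realType) :
  `]0, +oo[%classic = \bigcup_n `[n.+1%:R^-1 : R, n.+2%:R]%classic.
Proof.
apply/seteqP; split=> t /=; last first.
  move=> [n _] /=; rewrite !in_itv/= andbT => /andP[nt _].
  by apply: lt_le_trans nt; rewrite invr_gt0.
rewrite in_itv/= andbT => t0.
have tV0 : 0 < t^-1 by rewrite invr_gt0.
pose n := maxn (Num.bound t) (Num.bound t^-1).
have le_n m : (m <= n)%N -> m%:R <= n.+1%:R :> R.
  by move=> mn; rewrite ler_nat ltnW.
exists n => //=; rewrite in_itv/=; apply/andP; split.
- rewrite -[leRHS]invrK lef_pV2 ?posrE//.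
  exact: le_trans (ltW (archi_boundP (ltW tV0))) (le_n _ (leq_maxr _ _)).
- apply: le_trans (ltW (archi_boundP (ltW t0))) _.
  by apply: le_trans (le_n _ (leq_maxl _ _)) _; rewrite ler_nat.
Qed.

Lemma cvg_euler_integral (R : realType) (q : R) :
  (\int[lebesgue_measure]_(t in `[n.+1%:R^-1%R, n.+2%:R%R])
     (t `^ q * expR (- t))%:E @[n --> \oo] -->
   \int[lebesgue_measure]_(t in `]0%R, +oo[) (t `^ q * expR (- t))%:E)%E.
Proof.
rewrite itv0y_bigcup; apply: ge0_nondecreasing_set_cvg_integral => //.
- apply/nondecreasing_seqP => n; apply/subsetPset => t /=.
  rewrite !in_itv/= => /andP[nt tn]; apply/andP; split.
    by apply: le_trans nt; rewrite lef_pV2 ?posrE// ler_nat.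
  by apply: le_trans tn _; rewrite ler_nat.
- move=> n; apply/measurable_EFinP; apply: measurable_funM.
    by apply: measurable_funTS; exact: measurable_powR.
  by apply: measurable_funTS; apply: measurableT_comp => //; exact: measurable_expR.
- by move=> n t _; rewrite lee_fin mulr_ge0 ?powR_ge0 ?expR_ge0.
Qed.

(** Limit of the integration by parts over [1/(n+1), n+2]: the boundary term at
    the left vanishes because p > 0, the one at the right by exponential
    decay. *)
Lemma euler_integralD1 (R : realType) (p : R) : 0 < p ->
  euler_integral (p + 1) = p * euler_integral p.
Proof.
move=> p0; rewrite /euler_integral /Rintegral addrK.
rewrite -fine_pZl ?gt_eqF//; congr fine.
pose a (n : nat) : R := n.+1%:R^-1; pose b (n : nat) : R := n.+2%:R.
have bdry0 : a n `^ p * expR (- a n) - b n `^ p * expR (- b n) @[n --> \oo] --> 0.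
  rewrite -[X in _ --> X]subr0; apply: cvgB.
    apply: (@squeeze_cvgr _ _ _ _ (fun=> 0) (fun n => a n `^ p)); last 2 first.
    - exact: cvg_cst.
    - have /cvg_at_rightP := powR_cvg0 p0; apply; split; last exact: cvg_harmonic.
      by move=> n; rewrite invr_gt0.
    apply: nearW => n; rewrite mulr_ge0 ?powR_ge0 ?expR_ge0//=.
    by rewrite ler_piMr ?powR_ge0// expR_le1 oppr_le0 invr_ge0.
  have [C HC] := @powR_expRN_le R p.
  apply: (@squeeze_cvgr _ _ _ _ (fun=> 0) (fun n => C * (b n)^-1)); last 2 first.
  - exact: cvg_cst.
  - rewrite -[X in _ --> X](mulr0 C); apply: cvgMl_tmp.
    by have := @cvg_harmonic R; rewrite -cvg_shiftS.
  apply: nearW => n; rewrite mulr_ge0 ?powR_ge0 ?expR_ge0//=.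
  by apply: HC; rewrite ler1n.
have lhs := @cvg_euler_integral R p.
have rhs : (fun n => ((a n `^ p * expR (- a n) - b n `^ p * expR (- b n))%:E +
    p%:E * \int[lebesgue_measure]_(t in `[a n, b n]) (t `^ (p - 1) * expR (- t))%:E)%E)
  @ \oo --> (p%:E * \int[lebesgue_measure]_(t in `]0%R, +oo[) (t `^ (p - 1) * expR (- t))%:E)%E.
  rewrite -[X in _ --> X]add0e; apply: cvgeD => //.
  - by apply: cvg_EFin; [exact: nearW|exact: bdry0].
  - by apply: cvgeZl => //; exact: cvg_euler_integral.
apply: (cvg_unique _ lhs) => //.
apply: cvg_trans rhs; apply: near_eq_cvg; apply: nearW => n /=.
rewrite -euler_integral_by_parts// /a /b ?invr_gt0//.
by apply: (@le_lt_trans _ _ 1); rewrite ?invf_le1 ?ler1n ?ltr1n.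
Qed.

Lemma euler_integral_ge0 (R : realType) (p : R) : 0 <= euler_integral p.
Proof.
apply: fine_ge0; apply: integral_ge0 => t _.
by rewrite lee_fin mulr_ge0 ?powR_ge0 ?expR_ge0.
Qed.

(** * The Gamma function and the coefficients *)

Lemma Gamma_gt0E (R : realType) (x : R) : 0 < x -> Gamma x = euler_integral x.
Proof.
move=> x0; rewrite /Gamma.
have -> : Num.truncn (1 - x) = 0%N.
  by apply/truncn0Pn; rewrite -ltNge; lra.
by rewrite addr0 big_ord0 divr1.
Qed.

(** For x > 0 this is the functional equation of Euler's integral; for x <= 0
    the continuation of Gamma is defined by it.  Stating it for 1 / Gamma
    covers the poles too: at x = 0 both sides are 0. *)
Lemma Gamma_invD1 (R : realType) (x : R) :
  (Gamma x)^-1 = x * (Gamma (x + 1))^-1.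
Proof.
have [x0|x0] := ltP 0 x.
  rewrite !Gamma_gt0E ?addr_gt0// euler_integralD1// invfM mulrA.
  by rewrite divff ?mul1r// gt_eqF.
rewrite /Gamma; have -> : 1 - (x + 1) = - x by ring.
have -> : Num.truncn (1 - x) = (Num.truncn (- x)).+1.
  by rewrite truncnD ?truncn1 ?nnegrE ?oppr_ge0.
set k := Num.truncn _; rewrite big_ord_recl !invf_div -natr1.
rewrite addr0 (_ : x + (k%:R + 1) = x + 1 + k%:R); last by ring.
rewrite -mulrA; congr (_ * (_ / _)).
by apply: eq_bigr => m _; rewrite /= /bump/= add1n -natr1; ring.
Qed.

Lemma frac_coefD1 (R : realType) (alpha : R) (k : int) :
  (k%:~R + 1 + alpha / 2) * frac_coef alpha (k + 1) =
  (k%:~R - alpha / 2) * frac_coef alpha k.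
Proof.
rewrite /frac_coef !(invfM (Gamma _)).
have -> : (-1) ^ (k + 1) = - (-1) ^ k :> R.
  by rewrite expfzDr ?oppr_eq0 ?oner_eq0// expr1z mulrN1.
rewrite intrD mulr1z.
have -> : alpha / 2 - (k%:~R + 1) + 1 = alpha / 2 - k%:~R by ring.
have -> : alpha / 2 + (k%:~R + 1) + 1 = (alpha / 2 + k%:~R + 1) + 1 by ring.
rewrite (Gamma_invD1 _ (alpha / 2 - k%:~R)) (Gamma_invD1 _ (alpha / 2 + k%:~R + 1)).
ring.
Qed.

Lemma frac_coefN (R : realType) (alpha : R) (k : int) :
  frac_coef alpha (- k) = frac_coef alpha k.
Proof.
rewrite /frac_coef mulrNz opprK [X in _ / X = _]mulrC.
by congr (_ * _ / _); rewrite -exprz_inv invrN1.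
Qed.

Lemma frac_coef0_ge0 (R : realType) (alpha : R) :
  0 < alpha -> 0 <= frac_coef alpha 0.
Proof.
move=> alpha_gt0; rewrite /frac_coef expr0z mul1r mulr0z subr0 addr0.
by rewrite !Gamma_gt0E ?divr_ge0 ?mulr_ge0 ?euler_integral_ge0//; lra.
Qed.

Lemma frac_coef1 (R : realType) (alpha : R) : 0 < alpha ->
  frac_coef alpha 1 = - (alpha / (alpha + 2) * frac_coef alpha 0).
Proof.
move=> alpha_gt0; have := frac_coefD1 _ alpha 0; rewrite add0r mulr0z !add0r => e.
have d0 : alpha + 2 != 0 by rewrite gt_eqF//; lra.
move: (frac_coef alpha 1) (frac_coef alpha 0) e => c1 c0 e.
have f : (alpha + 2) * (alpha / (alpha + 2)) = alpha by rewrite mulrC divfK.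
by apply: (mulfI d0); rewrite mulrN mulrA f; lra.
Qed.

(** The ratio (n - alpha/2) / (n + 1 + alpha/2) of successive coefficients is
    nonnegative as soon as n >= 1, since alpha / 2 <= 1; so the sign of c_1
    persists. *)
Lemma frac_coef_le0 (R : realType) (alpha : R) (n : nat) :
  0 < alpha -> alpha <= 2 -> (0 < n)%N -> frac_coef alpha n%:Z <= 0.
Proof.
move=> alpha_gt0 alpha_le2; case: n => // n _; elim: n => [|n IHn].
  rewrite frac_coef1// oppr_le0 mulr_ge0 ?frac_coef0_ge0//.
  by rewrite divr_ge0 ?addr_ge0 ?ltW.
have := frac_coefD1 _ alpha n.+1%:Z; rewrite -PoszD addn1 -pmulrn => e.
have n1 : 1 <= n.+1%:R :> R by rewrite ler1n.
have: 0 < n.+1%:R + 1 + alpha / 2 by lra.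
move/pmulr_rle0 <-; rewrite e; apply: mulr_ge0_le0 => //; lra.
Qed.

(** The recurrence reads alpha c_k = a_(k-1) - a_k with
    a_k = (k - alpha/2) c_k, so the sum telescopes to
    (a_(i-n) - a_(i-m)) / alpha.  Here a_(i-n) >= 0 >= a_(i-m), by the signs of
    the coefficients and because i - n <= -1 and i - m >= 0. *)
Lemma sum_frac_coef_ge0 (R : realType) (alpha : R) (m i n : nat) :
  0 < alpha -> alpha <= 2 -> (m <= i < n)%N ->
  0 <= \sum_(m <= s < n) frac_coef alpha (i%:Z - s%:Z).
Proof.
move=> alpha_gt0 alpha_le2 /andP[mi i_n].
pose f (s : nat) := (i%:R - s%:R - alpha / 2) * frac_coef alpha (i%:Z - s%:Z).
have cE (s : nat) : frac_coef alpha (i%:Z - s%:Z) = (f s.+1 - f s) / alpha.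
  have := frac_coefD1 _ alpha (i%:Z - s.+1%:Z).
  rewrite (_ : i%:Z - s.+1%:Z + 1 = i%:Z - s%:Z)%R; last by lia.
  rewrite intrD mulrNz -!pmulrn -(natr1 s) => e.
  rewrite /f -(natr1 s); apply: (mulIf (lt0r_neq0 alpha_gt0)).
  by rewrite divfK ?gt_eqF// -e; field.
rewrite (eq_bigr (fun s => (f s.+1 - f s) / alpha) (fun s _ => cE s)).
rewrite -mulr_suml telescope_sumr ?(leq_trans mi (ltnW i_n))//.
rewrite divr_ge0 ?(ltW alpha_gt0)// subr_ge0 /f.
apply: (@le_trans _ _ 0).
  have [->|im] := eqVneq m i.
    by rewrite !subrr add0r mulNr oppr_le0 mulr_ge0 ?frac_coef0_ge0//; lra.
  have {im}mi : (m < i)%N by rewrite ltn_neqAle im.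
  rewrite -natrB ?(ltnW mi)// subzn ?(ltnW mi)//.
  rewrite mulr_ge0_le0 ?frac_coef_le0 ?subn_gt0//.
  have : 1 <= (i - m)%:R :> R by rewrite ler1n subn_gt0.
  lra.
rewrite -frac_coefN opprB subzn ?(ltnW i_n)// mulr_le0 ?frac_coef_le0 ?subn_gt0//.
have : i%:R <= n%:R :> R by rewrite ler_nat ltnW.
lra.
Qed.

(** * Maximum principles on a grid line *)

Lemma frac_coef_offdiag_le0 (R : realType) (alpha : R) (i s : nat) :
  0 < alpha -> alpha <= 2 -> s != i -> frac_coef alpha (i%:Z - s%:Z) <= 0.
Proof.
move=> a0 a2; rewrite neq_ltn => /orP[si|is_].
- by rewrite subzn ?(ltnW si)//; apply: frac_coef_le0; rewrite ?subn_gt0.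
- rewrite -frac_coefN opprB subzn ?(ltnW is_)//.
  by apply: frac_coef_le0; rewrite ?subn_gt0.
Qed.

Definition line_op {R : realType} (alpha b : R) (M : nat) (v : nat -> R)
    (i : nat) : R := average alpha v i + b * frac_diff alpha M v i.

Lemma line_opN (R : realType) (alpha b : R) (M : nat) (v : nat -> R) (i : nat) :
  line_op alpha b M (fun s => - v s) i = - line_op alpha b M v i.
Proof.
rewrite /line_op /frac_diff.
have -> : \sum_(1 <= s < M) frac_coef alpha (i%:Z - s%:Z) * - v s =
    - \sum_(1 <= s < M) frac_coef alpha (i%:Z - s%:Z) * v s.
  by rewrite -sumrN; apply: eq_bigr => s _; rewrite mulrN.
rewrite /average; ring.
Qed.

(** All the entries of the matrix are nonnegative: the diagonal one is
    1 - alpha/12 - b c_0, the others are - b c_s plus, for the neighbours,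
    alpha/24. *)
Lemma explicit_line_op_ge0 (R : realType) (alpha b : R) (M : nat)
    (w : nat -> R) (i : nat) :
  0 < alpha -> alpha <= 2 -> 0 <= b -> b * frac_coef alpha 0 <= 1 - alpha / 12 ->
  (0 < i < M)%N -> (forall s, (s <= M)%N -> 0 <= w s) ->
  0 <= line_op alpha b M w i.
Proof.
move=> a0 a2 b0 bc /andP[i0 iM] w0.
rewrite /line_op /average /frac_diff (@big_cat_nat _ _ _ i)//= ?(ltnW iM)//.
rewrite (big_ltn iM) subrr.
have neg m n : (m <= n)%N -> (n <= M)%N -> (n <= i)%N || (i < m)%N ->
    \sum_(m <= s < n) frac_coef alpha (i%:Z - s%:Z) * w s <= 0.
  move=> mn nM ni; rewrite big_nat; apply: sumr_le0 => s /andP[ms sn].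
  rewrite mulr_le0_ge0 ?w0 ?(leq_trans (ltnW sn))// frac_coef_offdiag_le0//; lia.
have := neg 1%N i i0 (ltnW iM); rewrite leqnn => /(_ isT).
have := neg i.+1 M iM (leqnn M); rewrite ltnSn orbT => /(_ isT).
move: (\sum_(_ <= s < _) _) (\sum_(_ <= s < _) _) => S2 S1 S2le S1le.
have h1 : 0 <= alpha / 24 * w i.-1 by rewrite mulr_ge0 ?w0//; [lra|lia].
have h2 : 0 <= alpha / 24 * w i.+1 by rewrite mulr_ge0 ?w0//; lra.
have h3 : 0 <= (1 - alpha / 12 - b * frac_coef alpha 0) * w i.
  by rewrite mulr_ge0 ?w0 ?(ltnW iM)//; lra.
have h4 : b * (S1 + S2) <= 0 by rewrite mulr_ge0_le0//; lra.
move: (frac_coef alpha 0) h3 => c0 h3; nra.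
Qed.

(** The operator is nonnegative on G - v and on G + v, and it maps the
    constant G to G - b G (sum of the c_(i-s)) <= G. *)
Lemma explicit_line_op_le (R : realType) (alpha b G : R) (M : nat)
    (v : nat -> R) (i : nat) :
  0 < alpha -> alpha <= 2 -> 0 <= b -> b * frac_coef alpha 0 <= 1 - alpha / 12 ->
  (0 < i < M)%N -> (forall s, (s <= M)%N -> `|v s| <= G) ->
  `|line_op alpha b M v i| <= G.
Proof.
move=> a0 a2 b0 bc iM vG.
have G0 : 0 <= G := le_trans (normr_ge0 _) (vG 0%N isT).
have one_sided (u : nat -> R) : (forall s, (s <= M)%N -> u s <= G) ->
    line_op alpha b M u i <= G.
  move=> uG; have : 0 <= line_op alpha b M (fun s => G - u s) i.
    by apply: explicit_line_op_ge0 => // s sM; rewrite subr_ge0 uG.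
  have -> : line_op alpha b M (fun s => G - u s) i =
      G - b * (\sum_(1 <= s < M) frac_coef alpha (i%:Z - s%:Z)) * G
      - line_op alpha b M u i.
    rewrite /line_op /frac_diff.
    have -> : \sum_(1 <= s < M) frac_coef alpha (i%:Z - s%:Z) * (G - u s) =
        (\sum_(1 <= s < M) frac_coef alpha (i%:Z - s%:Z)) * G
        - \sum_(1 <= s < M) frac_coef alpha (i%:Z - s%:Z) * u s.
      by rewrite mulr_suml -sumrB; apply: eq_bigr => s _; rewrite mulrBr.
    by rewrite /average; field.
  have : 0 <= b * (\sum_(1 <= s < M) frac_coef alpha (i%:Z - s%:Z)) * G.
    by rewrite !mulr_ge0// sum_frac_coef_ge0.
  lra.
rewrite ler_norml; apply/andP; split.
  rewrite lerNl -line_opN; apply: one_sided => s sM.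
  by apply: le_trans (vG s sM); rewrite -normrN ler_norm.
by apply: one_sided => s sM; exact: le_trans (ler_norm _) (vG s sM).
Qed.

(** At an interior index i where v is largest, put d_s = v_i - v_s >= 0.  Then
    (A - b Delta) v_i - v_i is
      b v_i (sum of c_(i-s)) - b (sum of c_(i-s) d_s)
        - alpha/24 (d_(i-1) + d_(i+1)),
    the sums being over 0 <= s <= M.  The first term is nonnegative, since
    v_i >= v_0 = 0.  In the second sum only the two neighbours are kept, the
    other terms having the good sign; together with the last term they give
    - (alpha/24 + b c_1) (d_(i-1) + d_(i+1)) >= 0.  So v_i <= (A - b Delta) v_i.
    At a boundary index v is 0. *)
Lemma implicit_line_op_le_one_sided (R : realType) (alpha b G : R) (M : nat)
    (v : nat -> R) :
  0 < alpha -> alpha <= 2 -> 0 <= b -> alpha / 24 + b * frac_coef alpha 1 <= 0 ->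
  0 <= G -> v 0%N = 0 -> v M = 0 ->
  (forall i, (0 < i < M)%N -> line_op alpha (- b) M v i <= G) ->
  forall i, (i <= M)%N -> v i <= G.
Proof.
move=> a0 a2 b0 bc G0 v0 vM LG.
have [i _ imax] := @arg_maxP _ _ 'I_M.+1 ord0 xpredT (fun j => v j) isT.
have vi_max s : (s <= M)%N -> v s <= v i.
  by move=> sM; exact: (imax (Ordinal (sM : (s < M.+1)%N)) isT).
suff viG : v i <= G by move=> s sM; exact: le_trans (vi_max s sM) viG.
have [i0|i0] := posnP i; first by rewrite i0 v0.
have [->|iM] := eqVneq (i : nat) M; first by rewrite vM.
have {}iM : (i < M)%N by rewrite ltn_neqAle iM -ltnS ltn_ord.
apply: le_trans (LG i _); last by rewrite i0.
have vi0 : 0 <= v i by rewrite -v0; exact: vi_max.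
pose c (s : nat) := frac_coef alpha (i%:Z - s%:Z).
pose d (s : nat) := v i - v s.
have d0 s : (s <= M)%N -> 0 <= d s by move=> sM; rewrite subr_ge0 vi_max.
(* Since v vanishes at 0 and M, the sum may be taken over 0 <= s <= M, so that
   both neighbours of i occur in it even when i is next to the boundary. *)
have sumE : \sum_(1 <= s < M) c s * v s =
    v i * (\sum_(0 <= s < M.+1) c s) - \sum_(0 <= s < M.+1) c s * d s.
  have M0 : (0 < M)%N by exact: ltn_trans iM.
  transitivity (\sum_(0 <= s < M.+1) c s * v s).
    by rewrite big_nat_recr//= [in RHS]big_ltn// v0 vM !mulr0 add0r addr0.
  rewrite mulr_sumr -sumrB; apply: eq_bigr => s _; rewrite /d; ring.
have sumd : \sum_(0 <= s < M.+1) c s * d s <=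
    frac_coef alpha 1 * d i.-1 + frac_coef alpha 1 * d i.+1.
  rewrite (@big_cat_nat _ _ _ i)//= ?leqW ?(ltnW iM)//.
  rewrite -[X in \sum_(0 <= s < X) _](prednK i0) big_nat_recr//=.
  rewrite [X in _ + X]big_ltn ?leqW// [X in _ + (_ + X)]big_ltn//.
  have dii : d i = 0 by rewrite /d subrr.
  have cl : c i.-1 = frac_coef alpha 1 by rewrite /c; congr frac_coef; lia.
  have cr : c i.+1 = frac_coef alpha 1.
    by rewrite /c -frac_coefN; congr frac_coef; lia.
  have neg m n : (n <= M.+1)%N -> (n <= i)%N || (i < m)%N ->
      \sum_(m <= s < n) c s * d s <= 0.
    move=> nM ni; rewrite big_nat; apply: sumr_le0 => s /andP[ms sn].
    rewrite mulr_le0_ge0 ?d0 ?frac_coef_offdiag_le0//; lia.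
  have n1 := neg 0%N i.-1; have n2 := neg i.+2 M.+1.
  rewrite dii cl cr mulr0 add0r.
  have {}n1 := n1 ltac:(lia) ltac:(lia); have {}n2 := n2 ltac:(lia) ltac:(lia).
  lra.
have sumc : 0 <= v i * \sum_(0 <= s < M.+1) c s.
  by rewrite mulr_ge0// sum_frac_coef_ge0// leq0n leqW.
have nb (j : nat) : (j <= M)%N -> (alpha / 24 + b * frac_coef alpha 1) * d j <= 0.
  by move=> jM; rewrite mulr_le0_ge0// d0.
have nbl := nb i.-1 ltac:(lia); have nbr := nb i.+1 iM.
rewrite /line_op /average /frac_diff -/c sumE mulrNN.
have vl : v i.-1 = v i - d i.-1 by rewrite /d subKr.
have vr : v i.+1 = v i - d i.+1 by rewrite /d subKr.
rewrite vl vr.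
move: (\sum_(0 <= s < M.+1) c s) (\sum_(0 <= s < M.+1) c s * d s) sumd sumc.
move=> Sc Sd sumd sumc.
have h1 : 0 <= b * (v i * Sc) by rewrite mulr_ge0.
have h2 : b * Sd <=
    b * (frac_coef alpha 1 * d i.-1 + frac_coef alpha 1 * d i.+1).
  by rewrite ler_wpM2l.
move: (frac_coef alpha 1) (d i.-1) (d i.+1) h2 nbl nbr => c1 dl dr h2 nbl nbr.
rewrite mulrBr; lra.
Qed.

Lemma implicit_line_op_le (R : realType) (alpha b G : R) (M : nat)
    (v : nat -> R) :
  0 < alpha -> alpha <= 2 -> 0 <= b -> alpha / 24 + b * frac_coef alpha 1 <= 0 ->
  0 <= G -> v 0%N = 0 -> v M = 0 ->
  (forall i, (0 < i < M)%N -> `|line_op alpha (- b) M v i| <= G) ->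
  forall i, (i <= M)%N -> `|v i| <= G.
Proof.
move=> a0 a2 b0 bc G0 v0 vM LG i iM; rewrite ler_norml lerNl; apply/andP; split.
  apply: (@implicit_line_op_le_one_sided R alpha b G M (fun s => - v s)) => //.
  - by rewrite v0 oppr0.
  - by rewrite vM oppr0.
  - by move=> j jM; rewrite line_opN (le_trans _ (LG j jM))// -normrN ler_norm.
apply: (@implicit_line_op_le_one_sided R alpha b G M v) => // j jM.
exact: le_trans (ler_norm _) (LG j jM).
Qed.

(** * The operators on the grid *)

Lemma op_x_interior (R : realType) (alpha b : R) (Mx My Mz : nat)
    (u : gridfun R) (i j k : nat) : Defs.interior Mx My Mz i j k ->
  op_x alpha Mx My Mz b u i j k = line_op alpha b Mx (fun s => u s j k) i.
Proof. by move=> ijk; rewrite /op_x /A_x /Delta_x /zero_boundary ijk. Qed.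

Lemma op_y_interior (R : realType) (alpha b : R) (Mx My Mz : nat)
    (u : gridfun R) (i j k : nat) : Defs.interior Mx My Mz i j k ->
  op_y alpha Mx My Mz b u i j k = line_op alpha b My (fun s => u i s k) j.
Proof. by move=> ijk; rewrite /op_y /A_y /Delta_y /zero_boundary ijk. Qed.

Lemma op_z_interior (R : realType) (alpha b : R) (Mx My Mz : nat)
    (u : gridfun R) (i j k : nat) : Defs.interior Mx My Mz i j k ->
  op_z alpha Mx My Mz b u i j k = line_op alpha b Mz (fun s => u i j s) k.
Proof. by move=> ijk; rewrite /op_z /A_z /Delta_z /zero_boundary ijk. Qed.

Definition grid_le {R : realType} (Mx My Mz : nat) (G : R) (u : gridfun R) :
    Prop :=
  forall i j k, on_grid Mx My Mz i j k -> `|u i j k| <= G.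

Lemma dirichlet_grid_le (R : realType) (Mx My Mz : nat) (G : R)
    (u : gridfun R) : 0 <= G -> dirichlet Mx My Mz u ->
  (forall i j k, Defs.interior Mx My Mz i j k -> `|u i j k| <= G) ->
  grid_le Mx My Mz G u.
Proof.
move=> G0 u0 uG i j k g; have [|out] := boolP (Defs.interior Mx My Mz i j k).
  exact: uG.
by rewrite u0// normr0.
Qed.

Lemma interior_on_grid (Mx My Mz i j k : nat) :
  Defs.interior Mx My Mz i j k -> on_grid Mx My Mz i j k.
Proof. rewrite /Defs.interior /on_grid; lia. Qed.

(** The two sides of the condition on the time step, as they bear on
    b = dt eps^2 / (2 h^alpha).  The bound on b c_0 makes the entries of
    A + b Delta nonnegative; the one on b c_1 makes the off-diagonal entries of
    A - b Delta nonpositive. *)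
Definition stable_ratio {R : realType} (alpha b : R) : Prop :=
  [/\ 0 <= b, b * frac_coef alpha 0 <= 1 - alpha / 12 &
      alpha / 24 + b * frac_coef alpha 1 <= 0].

Lemma op_x_le (R : realType) (alpha b G : R) (Mx My Mz : nat) (u : gridfun R) :
  0 < alpha -> alpha <= 2 -> 0 <= G -> stable_ratio alpha b ->
  grid_le Mx My Mz G u ->
  grid_le Mx My Mz G (op_x alpha Mx My Mz b u).
Proof.
move=> a0 a2 G0 [b0 b_le _] uG.
apply: dirichlet_grid_le => // [i j k _ out|i j k ijk].
  by rewrite /op_x /A_x /Delta_x /zero_boundary (negbTE out) mulr0 addr0.
rewrite op_x_interior//; have /and3P[iM jM kM] := ijk.
apply: explicit_line_op_le => // s sM; apply: uG.
by move: ijk sM; rewrite /Defs.interior /on_grid; lia.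
Qed.

Lemma op_y_le (R : realType) (alpha b G : R) (Mx My Mz : nat) (u : gridfun R) :
  0 < alpha -> alpha <= 2 -> 0 <= G -> stable_ratio alpha b ->
  grid_le Mx My Mz G u ->
  grid_le Mx My Mz G (op_y alpha Mx My Mz b u).
Proof.
move=> a0 a2 G0 [b0 b_le _] uG.
apply: dirichlet_grid_le => // [i j k _ out|i j k ijk].
  by rewrite /op_y /A_y /Delta_y /zero_boundary (negbTE out) mulr0 addr0.
rewrite op_y_interior//; have /and3P[iM jM kM] := ijk.
apply: explicit_line_op_le => // s sM; apply: uG.
by move: ijk sM; rewrite /Defs.interior /on_grid; lia.
Qed.

Lemma op_z_le (R : realType) (alpha b G : R) (Mx My Mz : nat) (u : gridfun R) :
  0 < alpha -> alpha <= 2 -> 0 <= G -> stable_ratio alpha b ->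
  grid_le Mx My Mz G u ->
  grid_le Mx My Mz G (op_z alpha Mx My Mz b u).
Proof.
move=> a0 a2 G0 [b0 b_le _] uG.
apply: dirichlet_grid_le => // [i j k _ out|i j k ijk].
  by rewrite /op_z /A_z /Delta_z /zero_boundary (negbTE out) mulr0 addr0.
rewrite op_z_interior//; have /and3P[iM jM kM] := ijk.
apply: explicit_line_op_le => // s sM; apply: uG.
by move: ijk sM; rewrite /Defs.interior /on_grid; lia.
Qed.

Lemma op_x_solve_le (R : realType) (alpha b G : R) (Mx My Mz : nat)
    (u : gridfun R) :
  0 < alpha -> alpha <= 2 -> 0 <= G -> stable_ratio alpha b ->
  dirichlet Mx My Mz u ->
  (forall i j k, Defs.interior Mx My Mz i j k ->
     `|op_x alpha Mx My Mz (- b) u i j k| <= G) ->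
  grid_le Mx My Mz G u.
Proof.
move=> a0 a2 G0 [b0 _ b_ge] u0 LG; apply: dirichlet_grid_le => // i j k ijk.
apply: (@implicit_line_op_le R alpha b G Mx (fun s => u s j k)) => //.
- by apply: u0; move: ijk; rewrite /Defs.interior /on_grid; lia.
- by apply: u0; move: ijk; rewrite /Defs.interior /on_grid; lia.
- move=> s sM; have sjk : Defs.interior Mx My Mz s j k.
    by move: ijk; rewrite /Defs.interior sM => /andP[].
  by rewrite -(op_x_interior R alpha (- b) Mx My Mz u s j k sjk) LG.
- by move: ijk; rewrite /Defs.interior; lia.
Qed.

Lemma op_y_solve_le (R : realType) (alpha b G : R) (Mx My Mz : nat)
    (u : gridfun R) :
  0 < alpha -> alpha <= 2 -> 0 <= G -> stable_ratio alpha b ->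
  dirichlet Mx My Mz u ->
  (forall i j k, Defs.interior Mx My Mz i j k ->
     `|op_y alpha Mx My Mz (- b) u i j k| <= G) ->
  grid_le Mx My Mz G u.
Proof.
move=> a0 a2 G0 [b0 _ b_ge] u0 LG; apply: dirichlet_grid_le => // i j k ijk.
apply: (@implicit_line_op_le R alpha b G My (fun s => u i s k)) => //.
- by apply: u0; move: ijk; rewrite /Defs.interior /on_grid; lia.
- by apply: u0; move: ijk; rewrite /Defs.interior /on_grid; lia.
- move=> s sM; have isk : Defs.interior Mx My Mz i s k.
    by move: ijk; rewrite /Defs.interior sM => /and3P[-> _ ->].
  by rewrite -(op_y_interior R alpha (- b) Mx My Mz u i s k isk) LG.
- by move: ijk; rewrite /Defs.interior; lia.
Qed.

Lemma op_z_solve_le (R : realType) (alpha b G : R) (Mx My Mz : nat)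
    (u : gridfun R) :
  0 < alpha -> alpha <= 2 -> 0 <= G -> stable_ratio alpha b ->
  dirichlet Mx My Mz u ->
  (forall i j k, Defs.interior Mx My Mz i j k ->
     `|op_z alpha Mx My Mz (- b) u i j k| <= G) ->
  grid_le Mx My Mz G u.
Proof.
move=> a0 a2 G0 [b0 _ b_ge] u0 LG; apply: dirichlet_grid_le => // i j k ijk.
apply: (@implicit_line_op_le R alpha b G Mz (fun s => u i j s)) => //.
- by apply: u0; move: ijk; rewrite /Defs.interior /on_grid; lia.
- by apply: u0; move: ijk; rewrite /Defs.interior /on_grid; lia.
- move=> s sM; have ijs : Defs.interior Mx My Mz i j s.
    by move: ijk; rewrite /Defs.interior sM => /and3P[-> -> _].
  by rewrite -(op_z_interior R alpha (- b) Mx My Mz u i j s ijs) LG.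
- by move: ijk; rewrite /Defs.interior; lia.
Qed.

Lemma adi_solves_le (R : realType) (alpha bx by_ bz G : R) (Mx My Mz : nat)
    (u us uss v : gridfun R) :
  0 < alpha -> alpha <= 2 -> 0 <= G ->
  stable_ratio alpha bx -> stable_ratio alpha by_ -> stable_ratio alpha bz ->
  adi_solves alpha bx by_ bz Mx My Mz u us uss v ->
  grid_le Mx My Mz G u -> grid_le Mx My Mz G v.
Proof.
move=> a0 a2 G0 stx sty stz [[dus duss dv] eqx eqy eqz] uG.
have usG : grid_le Mx My Mz G us.
  apply: (@op_x_solve_le R alpha bx) => // i j k ijk; rewrite eqx//.
  apply: op_x_le (interior_on_grid _ _ _ _ _ _ ijk) => //.
  by apply: op_y_le => //; exact: op_z_le.
have ussG : grid_le Mx My Mz G uss.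
  apply: (@op_y_solve_le R alpha by_) => // i j k ijk.
  by rewrite eqy// usG// interior_on_grid.
apply: (@op_z_solve_le R alpha bz) => // i j k ijk.
by rewrite eqz// ussG// interior_on_grid.
Qed.

(** * One time step *)

(** 1 - x^2 >= 0, so the number under the square root is at least x^2. *)
Lemma reaction_le1 (R : realType) (dt x : R) :
  `|x| <= 1 -> `|reaction dt x| <= 1.
Proof.
move=> x1; rewrite /reaction normrM normfV.
set y := Num.sqrt _; rewrite [X in _ / X]ger0_norm ?sqrtr_ge0//.
have xy : `|x| <= y.
  rewrite -sqrtr_sqr; apply: ler_wsqrtr; rewrite lerDl mulr_ge0 ?expR_ge0//.
  by rewrite subr_ge0 -real_normK ?num_real// expr_le1.
have [y0|y0] := eqVneq y 0; first by rewrite y0 invr0 mulr0.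
by rewrite ler_pdivrMr ?mul1r// lt_neqAle eq_sym y0 sqrtr_ge0.
Qed.

(** Multiplied by eps^2 c_0 / (2 h^alpha), the bounds on dt become
    (alpha + 2) / 24 <= beta c_0 <= 1 - alpha / 12; the left one is
    alpha/24 + beta c_1 <= 0 because c_1 = - alpha / (alpha + 2) c_0. *)
Lemma adi_beta_stable (R : realType) (alpha eps dt h : R) :
  0 < alpha -> 0 < eps -> 0 < h -> 0 < frac_coef alpha 0 ->
  (alpha + 2) / 12 * (h `^ alpha / (eps ^+ 2 * frac_coef alpha 0)) <= dt ->
  dt <= (12 - alpha) / 6 * (h `^ alpha / (eps ^+ 2 * frac_coef alpha 0)) ->
  stable_ratio alpha (adi_beta alpha eps dt h).
Proof.
move=> a0 e0 h0 c0 lo hi; rewrite /stable_ratio frac_coef1// /adi_beta.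
have H0 : 0 < h `^ alpha by exact: powR_gt0.
have q0 : 0 < eps ^+ 2 by rewrite exprn_gt0.
move: (h `^ alpha) (eps ^+ 2) (frac_coef alpha 0) H0 q0 c0 lo hi.
move=> H q c H0 q0 c0.
rewrite !mulrA ler_pdivrMr ?mulr_gt0// ler_pdivlMr ?mulr_gt0// => lo hi.
have dt0 : 0 < dt.
  rewrite -(pmulr_lgt0 _ (mulr_gt0 q0 c0)); apply: lt_le_trans lo.
  by rewrite mulr_gt0// divr_gt0//; lra.
have bcE : dt * q / (2 * H) * c = (dt * (q * c)) / (2 * H) by ring.
have lo' : (alpha + 2) / 24 <= dt * q / (2 * H) * c.
  by rewrite bcE ler_pdivlMr ?mulr_gt0//; lra.
have hi' : dt * q / (2 * H) * c <= 1 - alpha / 12.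
  by rewrite bcE ler_pdivrMr ?mulr_gt0//; lra.
split => //; first by rewrite divr_ge0 ?mulr_ge0 ?ltW.
move: (dt * q / (2 * H)) lo' => b lo'.
have e : b * - (alpha / (alpha + 2) * c) = - (alpha / (alpha + 2) * (b * c)) by ring.
have a20 : 0 < alpha + 2 by lra.
have h2 : alpha / (alpha + 2) * ((alpha + 2) / 24) <= alpha / (alpha + 2) * (b * c).
  by rewrite ler_wpM2l// divr_ge0 ?ltW.
have h3 : alpha / (alpha + 2) * ((alpha + 2) / 24) = alpha / 24.
  by rewrite mulrA divfK// gt_eqF.
by rewrite e; lra.
Qed.

Lemma grid_norm_le (R : realType) (Mx My Mz : nat) (G : R) (u : gridfun R) :
  0 <= G -> grid_le Mx My Mz G u -> grid_norm Mx My Mz u <= G.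
Proof.
move=> G0 uG; rewrite /grid_norm.
have big_le (m n : nat) (F : nat -> R) : (forall s, (m <= s < n)%N -> F s <= G) ->
    \big[Num.max/0]_(m <= s < n) F s <= G.
  by move=> FG; rewrite big_nat; exact: bigmax_le.
apply: (big_le) => i iM; apply: (big_le) => j jM; apply: (big_le) => k kM.
by apply: uG; move: iM jM kM; rewrite /on_grid; lia.
Qed.

Theorem theorem4p3 (R : realType) (alpha eps T dt h1 h2 h3 : R)
    (Mx My Mz N : nat) (u0 : R -> R -> R -> R) (U : nat -> gridfun R)
    (alpha_gt1 : 1 < alpha) (alpha_le2 : alpha <= 2) (eps_gt0 : 0 < eps)
    (Mx_ge2 : (2 <= Mx)%N) (My_ge2 : (2 <= My)%N) (Mz_ge2 : (2 <= Mz)%N)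
    (h1E : h1 = Mx%:R^-1) (h2E : h2 = My%:R^-1) (h3E : h3 = Mz%:R^-1)
    (N_gt0 : (0 < N)%N) (T_gt0 : 0 < T) (dtE : dt = T / N%:R)
    (u0_boundary : forall x y z, on_cube_boundary x y z -> u0 x y z = 0)
    (u0_le1 : forall x y z, in_cube x y z -> `|u0 x y z| <= 1)
    (U_sol : numerical_solution alpha eps dt h1 h2 h3 Mx My Mz N u0 U)
    (dt_lower :
      (alpha + 2) / 12 *
        (Num.max (Num.max (h1 `^ alpha) (h2 `^ alpha)) (h3 `^ alpha) /
           (eps ^+ 2 * frac_coef alpha 0)) <= dt)
    (dt_upper :
      dt <= (12 - alpha) / 6 *
        (Num.min (Num.min (h1 `^ alpha) (h2 `^ alpha)) (h3 `^ alpha) /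
           (eps ^+ 2 * frac_coef alpha 0))) :
  forall n : nat, (n <= N)%N -> grid_norm Mx My Mz (U n) <= 1.
Proof.
have N0 : 0 < N%:R :> R by rewrite ltr0n.
have dt_gt0 : 0 < dt by rewrite dtE divr_gt0.
have alpha_gt0 : 0 < alpha by lra.
(* If c_0 were 0, the division by 0 in the upper bound would give dt <= 0. *)
have c0_gt0 : 0 < frac_coef alpha 0.
  rewrite lt_neqAle frac_coef0_ge0// andbT eq_sym; apply/eqP => c0.
  by move: dt_upper; rewrite c0 mulr0 invr0 !mulr0 leNgt dt_gt0.
have q_gt0 : 0 < eps ^+ 2 * frac_coef alpha 0 by rewrite mulr_gt0// exprn_gt0.
have stable (M : nat) (h : R) : h = M%:R^-1 -> (2 <= M)%N ->
    h `^ alpha <= Num.max (Num.max (h1 `^ alpha) (h2 `^ alpha)) (h3 `^ alpha) ->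
    Num.min (Num.min (h1 `^ alpha) (h2 `^ alpha)) (h3 `^ alpha) <= h `^ alpha ->
    stable_ratio alpha (adi_beta alpha eps dt h).
  move=> hE M2 hmax hmin; apply: adi_beta_stable => //.
  - by rewrite hE invr_gt0 ltr0n (leq_trans _ M2).
  - apply: le_trans dt_lower; apply: ler_wpM2l; first lra.
    by rewrite ler_wpM2r// invr_ge0 ltW.
  - apply: le_trans dt_upper _; apply: ler_wpM2l; first lra.
    by rewrite ler_wpM2r// invr_ge0 ltW.
have stx : stable_ratio alpha (adi_beta alpha eps dt h1).
  by apply: (stable Mx) => //; rewrite ?le_max ?ge_min lexx.
have sty : stable_ratio alpha (adi_beta alpha eps dt h2).
  by apply: (stable My) => //; rewrite ?le_max ?ge_min lexx ?orbT.
have stz : stable_ratio alpha (adi_beta alpha eps dt h3).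
  by apply: (stable Mz) => //; rewrite ?le_max ?ge_min lexx ?orbT.
have [U0 Ustep] := U_sol.
suff le1 n : (n <= N)%N -> grid_le Mx My Mz 1 (U n).
  by move=> n nN; apply: grid_norm_le => //; exact: le1.
elim: n => [_|n IHn nN].
  have unit_itv (M i : nat) : (2 <= M)%N -> (i <= M)%N ->
      0 <= (i%:R : R) * M%:R^-1 <= 1.
    move=> M2 iM; have M0 : 0 < M%:R :> R by rewrite ltr0n (leq_trans _ M2).
    by rewrite divr_ge0//= ler_pdivrMr// mul1r ler_nat.
  move=> i j k ijk; have /and3P[iM jM kM] := ijk; rewrite U0//.
  by apply: u0_le1; rewrite /in_cube h1E h2E h3E !unit_itv.
have [us [uss [v [adi UE]]]] := Ustep n nN.
have vG : grid_le Mx My Mz 1 v.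
  apply: (@adi_solves_le R alpha _ _ _ 1 Mx My Mz _ us uss v) adi _ => // i j k ijk.
  by apply: reaction_le1; exact: IHn (ltnW nN) i j k ijk.
by move=> i j k ijk; rewrite UE//; apply: reaction_le1; exact: vG.
Qed.
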